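(* Let $\gamma>0$ and let $X$ be, under $\mathbb{P}$, a uniformly ergodic Markov chain with time-homogeneous rate matrix $A$. For some arbitrarily chosen state $\hat x\in\mathcal{X}$, let $\hat\tau=\inf\{t:X_t=\hat x\}$. Then for any $\epsilon>0$ there exists a $\beta>0$, depending only on $A$ and $\gamma$, such that for any measure $\mathbb{Q}\in\mathcal{Q}_\gamma$, $$E^{\mathbb{Q}}\big[e^{\beta(\hat\tau-t)^+}\big|\mathcal{F}_t\big]\le1+\epsilon$$ for any $t$.
   Context: Setting. Let $N\in\mathbb{N}\cup\{\infty\}$ and let $\mathcal{X}=\{e_i\}$ be the set of standard basis vectors of $\mathbb{R}^N$ ($\mathbb{R}^\infty$ is the space of real sequences). Vectors are column vectors, $z^*$ is the transpose of $z$, and $\mathbf{1}\in\mathbb{R}^N$ is the vector with all entries $1$. On $(\Omega,\mathcal{F},\mathbb{P})$, $X$ is a right-continuous pure-jump continuous-time process with values in $\mathcal{X}$ which is a Markov chain in its own filtration under $\mathbb{P}$, with (possibly infinite) rate matrix $A$; here $A_{ij}$ is the rate of jumping from $e_j$ to $e_i$, so $A_{ij}\ge0$ for $i\ne j$ and $\sum_iA_{ij}=0$ for all $j$, and the entries of $A$ are uniformly bounded. $\mathcal{F}_t$ is the completion of $\sigma(X_s:s\le t)$ by the $\mathbb{P}$-null sets of $\mathcal{F}_\infty$, and $\mathcal{F}=\mathcal{F}_\infty$. Uniform ergodicity. $X$ is uniformly ergodic if there are a probability measure $\pi$ on $\mathcal{X}$ and constants $R,\rho>0$ such that $\sup_\mu\|P^A_t\mu-\pi\|_{TV}\le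 Re^{-\rho t}$ for all $t$, where the supremum is over all probability measures $\mu$ on $\mathcal{X}$, $P_t^A\mu$ is the law of $X_t$ given $X_0\sim\mu$ when $X$ evolves with rate matrix $A$, and $\|f\|_{TV}=\sum_x|f(x)|$. $\mathcal{Q}_\gamma$ is the family of all probability measures $\mathbb{Q}$ under which $X$ has compensator $\lambda$ (i.e. $X_t-X_0-\int_{]0,t]}\lambda(\omega,u)\,du$ is a $\mathbb{Q}$-martingale) for some predictable process $\lambda$ with $\mathbf{1}^*\lambda\equiv0$ and $(e_i^*\lambda(\omega,t))/(e_i^*AX_{t-})\in[\gamma,\gamma^{-1}]$ for all $i$, where $0/0:=1$.
   Formalization: The state x̂ is required to have positive mass under the ergodic limit law π (for transient states, such as a state never reached from an absorbing one, the claim is false); β may depend on ε and x̂ as well as on A and γ. *)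

(* Defs.v *)
From mathcomp Require Export all_boot all_order all_algebra.
From mathcomp Require Export all_classical all_reals all_analysis.
From mathcomp Require Export measurable_realfun.
Export Order.TTheory GRing.Theory Num.Theory.
Export numFieldNormedType.Exports.

Set Implicit Arguments.
Unset Strict Implicit.
Unset Printing Implicit Defensive.

Local Open Scope classical_set_scope.
Local Open Scope ring_scope.

(* N : option nat encodes N in {0, 1, 2, ...} U {oo}, with None for oo.  The
   basis vector e_i is identified with its index i : state N, and a vector of
   R^N with its coordinate function state N -> R. *)
Definition below (N : option nat) (k : nat) : bool :=
  if N is Some n then (k < n)%N else true.

Notation state N := {k : nat | below N k}.

(* 1^* v = s, a possibly infinite sum with entries of any sign. *)
Definition has_sum {R : realType} {N : option nat} (v : state N -> R) (s : R)
  : Prop :=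
  series (fun k : nat =>
    if (insub k : option (state N)) is Some i then v i else 0) @ \oo --> s.

Definition prob_vector {R : realType} {N : option nat} (mu : state N -> R)
  : Prop :=
  (forall i, 0 <= mu i) /\ \esum_(i in [set: state N]) (mu i)%:E = 1%E.

(* A i j is the rate of jumping from e_j to e_i. *)
Definition rate_matrix {R : realType} {N : option nat}
    (A : state N -> state N -> R) : Prop :=
  [/\ forall i j, i != j -> 0 <= A i j,
      forall j, has_sum (A ^~ j) 0
    & exists K : R, forall i j, `|A i j| <= K].

(* p t i j is the probability of being in e_i a time t after being in e_j. For
   a rate matrix A (which has bounded entries) there is exactly one such p on
   t >= 0, namely p t = exp (t A). *)
Definition transition_function {R : realType} {N : option nat}
    (A : state N -> state N -> R) (p : R -> state N -> state N -> R) : Prop :=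
  [/\ forall t j, 0 <= t -> prob_vector (p t ^~ j),
      forall i j, p 0 i j = (i == j)%:R,
      forall s t i j, 0 <= s -> 0 <= t ->
        \esum_(k in [set: state N]) (p s i k * p t k j)%:E = (p (s + t) i j)%:E
    & forall i j, h^-1 * (p h i j - (i == j)%:R) @[h --> 0^'+] --> A i j].

Definition push {R : realType} {N : option nat}
    (P : state N -> state N -> R) (mu : state N -> R) (i : state N) : R :=
  fine (\esum_(j in [set: state N]) (P i j * mu j)%:E).

Definition tv_norm {R : realType} {N : option nat} (f : state N -> R)
  : \bar R := \esum_(i in [set: state N]) `|f i|%:E.

(* Uniform ergodicity with limiting (hence invariant) law pi. *)
Definition uniformly_ergodic {R : realType} {N : option nat}
    (A : state N -> state N -> R) (pi : state N -> R) : Prop :=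
  prob_vector pi /\
  exists p : R -> state N -> state N -> R, transition_function A p /\
  exists C rho : R, [/\ 0 < C, 0 < rho & forall t, 0 <= t ->
    (ereal_sup [set tv_norm (fun i => (push (p t) mu i - pi i)%R)
               | mu in [set mu | prob_vector mu]]
       <= (C * expR (- rho * t))%:E)%E].

(* Processes are indexed by R, and only their values at times t >= 0 matter. *)

(* X_{t-} = e_j, with the convention X_{0-} = X_0. *)
Definition left_limit {R : realType} {N : option nat} (x : R -> state N)
    (t : R) (j : state N) : Prop :=
  if t == 0 then x 0 = j else \forall s \near t^'-, x s = j.

(* The state space is discrete, so right-continuous paths are locally constant
   on the right; a left limit in the state space at every t means that there
   are finitely many jumps on bounded time intervals. *)
Definition pure_jump {R : realType} {N : option nat} (x : R -> state N)
  : Prop :=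
  (forall t, 0 <= t -> \forall s \near t^'+, x s = x t) /\
  (forall t, 0 <= t -> exists j, left_limit x t j).

(* sigma(X_s : s in S) *)
Definition sigma_of {R : realType} {N : option nat} {Omega : Type}
    (X : R -> Omega -> state N) (S : set R) : set (set Omega) :=
  <<s [set B | exists2 s, S s & exists i, B = X s @^-1` [set i]] >>.

(* Subsets of P-null sets of sigma(X_s : s >= 0). *)
Definition null_sets {R : realType} {N : option nat} {d : measure_display}
    {Omega : measurableType d} (P : probability Omega R)
    (X : R -> Omega -> state N) : set (set Omega) :=
  [set B | exists C, [/\ sigma_of X `[0, +oo[ C, P C = 0%E & B `<=` C]].

Definition completed {R : realType} {N : option nat} {d : measure_display}
    {Omega : measurableType d} (P : probability Omega R)
    (X : R -> Omega -> state N) (S : set R) : set (set Omega) :=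
  <<s sigma_of X S `|` null_sets P X >>.

Definition filt {R : realType} {N : option nat} {d : measure_display}
    {Omega : measurableType d} (P : probability Omega R)
    (X : R -> Omega -> state N) (t : R) : set (set Omega) :=
  completed P X `[0, t].

Definition filt_oo {R : realType} {N : option nat} {d : measure_display}
    {Omega : measurableType d} (P : probability Omega R)
    (X : R -> Omega -> state N) : set (set Omega) :=
  completed P X `[0, +oo[.

(* g is a version of E^Q[f | G]; used for f nonnegative or integrable. *)
Definition is_cond_exp {R : realType} {d : measure_display}
    {Omega : measurableType d} (Q : probability Omega R)
    (G : set (set Omega)) (f g : Omega -> \bar R) : Prop :=
  (forall B : set (\bar R), measurable B -> G (g @^-1` B)) /\
  (forall B, G B -> (\int[Q]_(w in B) f w = \int[Q]_(w in B) g w)%E).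

Definition martingale {R : realType} {d : measure_display}
    {Omega : measurableType d} (Q : probability Omega R)
    (Fl : R -> set (set Omega)) (M : R -> Omega -> R) : Prop :=
  (forall t, 0 <= t -> Q.-integrable setT (EFin \o M t)) /\
  (forall s t, 0 <= s -> s <= t ->
     is_cond_exp Q (Fl s) (EFin \o M t) (EFin \o M s)).

(* The sets of the predictable sigma-algebra on [0, oo[ x Omega. *)
Definition predictable_sets {R : realType} {Omega : Type}
    (Fl : R -> set (set Omega)) : set (set (R * Omega)) :=
  <<s (`[0, +oo[ `*` setT),
      [set E | (exists2 B, Fl 0 B & E = [set 0] `*` B) \/
               (exists s t B,
                  [/\ 0 <= s, s < t, Fl s B & E = `]s, t] `*` B])] >>.

Definition predictable {R : realType} {Omega : Type}
    (Fl : R -> set (set Omega)) (l : R -> Omega -> R) : Prop :=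
  forall B : set R, measurable B ->
    predictable_sets Fl [set tw | 0 <= tw.1 /\ B (l tw.1 tw.2)].

(* a / b with 0 / 0 = 1; a / 0 is infinite when a <> 0. *)
Definition ratio {R : realType} (a b : R) : \bar R :=
  if b == 0 then (if a == 0 then 1%E else +oo%E) else (a / b)%:E.

Definition markov_chain {R : realType} {N : option nat} {d : measure_display}
    {Omega : measurableType d} (P : probability Omega R)
    (X : R -> Omega -> state N) (A : state N -> state N -> R) : Prop :=
  exists p : R -> state N -> state N -> R, transition_function A p /\
  forall s t i, 0 <= s -> 0 <= t ->
    is_cond_exp P (sigma_of X `[0, s])
      (fun w => ((X (s + t) w == i)%:R)%:E) (fun w => (p t i (X s w))%:E).

(* The vector processes X, lambda and the martingale are taken coordinatewise;
   e_i^* X_t is (X t w == i)%:R and e_i^* A X_{t-} is A i j for X_{t-} = e_j. *)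
Definition Qgamma {R : realType} {N : option nat} {d : measure_display}
    {Omega : measurableType d} (P : probability Omega R)
    (X : R -> Omega -> state N) (A : state N -> state N -> R) (gamma : R)
  : set (probability Omega R) :=
  [set Q | exists lambda : R -> Omega -> state N -> R,
    [/\ forall i, predictable (filt P X) (fun t w => lambda t w i),
        forall t w, 0 <= t -> has_sum (lambda t w) 0,
        forall t w i j, 0 <= t -> left_limit (X ^~ w) t j ->
          (gamma%:E <= ratio (lambda t w i) (A i j) <= (gamma^-1)%:E)%E
      & forall i, martingale Q (filt P X) (fun t w =>
          (X t w == i)%:R - (X 0 w == i)%:R
          - \int[lebesgue_measure]_(u in `]0, t]) lambda u w i)]].

(* inf {t : X_t = x}, with inf of the empty set = +oo. *)
Definition hitting_time {R : realType} {N : option nat} {Omega : Type}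
    (X : R -> Omega -> state N) (x : state N) (w : Omega) : \bar R :=
  ereal_inf [set t%:E | t in [set t | 0 <= t /\ X t w = x]].

(* Main.v *)
Require Import Defs.
From mathcomp Require Import ring lra.

(** Fix a large constant c. The resolvent psi(j) = int_0^oo exp(-ct) p_t(xhat,
    j) dt, cut off at a large time, lies between two positive constants by
    uniform ergodicity, and its generator satisfies (A^* psi)(j) >= c psi(j)
    off xhat. Every admissible compensator lambda dominates gamma A off the
    diagonal and is at least -K/gamma on it, so sum_i lambda_i psi(i) >= gamma
    c psi(j) - (K/gamma) psi(j) >= m > 0 at every j <> xhat, while this drift
    is bounded below everywhere. Thus psi(X), which is bounded, would drift
    upwards at a rate at least m as long as X avoids xhat: comparing
    E[psi(X_t) - psi(X_s); F] with the expected integral of the drift shows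
    that, given any F in F_s, X avoids xhat during [s, s + T] with probability
    at most some k < 1. No stopping at the hitting time is needed. Iterating
    gives a geometric tail for the hitting time, hence the exponential moment. *)

Set Implicit Arguments.
Unset Strict Implicit.
Unset Printing Implicit Defensive.

Local Open Scope classical_set_scope.
Local Open Scope ring_scope.

(** * Partial sums over the states *)

(** The truncations of the series behind [has_sum]. The estimates below are made on these finite
    sums, which commute with integrals and pointwise limits; the number of terms is sent to infinity
    only afterwards. *)
Definition psum {R : realType} {N : option nat} (v : state N -> R) (n : nat) : R :=
  series (fun k : nat =>
    if (insub k : option (state N)) is Some i then v i else 0) n.

Section PartialSums.
Context {R : realType} {N : option nat}.
Implicit Types (v w : state N -> R) (a s : R) (i j : state N).

Lemma has_sumE v s : has_sum v s = (psum v @ \oo --> s).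
Proof. by []. Qed.

Lemma psum0 v : psum v 0 = 0.
Proof. by rewrite /psum seriesEnat /= big_geq. Qed.

Lemma psumS v n : psum v n.+1 =
  psum v n + (if (insub n : option (state N)) is Some i then v i else 0).
Proof. by rewrite /psum seriesSr. Qed.

Lemma psumD v w n : psum (fun i => v i + w i) n = psum v n + psum w n.
Proof.
rewrite /psum !seriesEnat /= -big_split; apply: eq_bigr => k _.
by case: insub => //=; rewrite addr0.
Qed.

Lemma psumZ a v n : psum (fun i => a * v i) n = a * psum v n.
Proof.
rewrite /psum !seriesEnat /= mulr_sumr; apply: eq_bigr => k _.
by case: insub => //; rewrite mulr0.
Qed.

Lemma psumB v w n : psum (fun i => v i - w i) n = psum v n - psum w n.
Proof.
rewrite -[- psum w n]mulN1r -psumZ -psumD; congr psum.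
by apply/funext => i; rewrite mulN1r.
Qed.

Lemma psum_sum L (v : nat -> state N -> R) n :
  psum (fun i => \sum_(0 <= l < L) v l i) n = \sum_(0 <= l < L) psum (v l) n.
Proof.
elim: L => [|L IH]; last first.
  rewrite big_nat_recr//= -IH -psumD; congr psum; apply/funext => i.
  by rewrite big_nat_recr.
rewrite big_geq // /psum !seriesEnat /= big1// => k _.
by case: insub => // i; rewrite big_geq.
Qed.

Lemma ler_psum v w n : (forall i, v i <= w i) -> psum v n <= psum w n.
Proof.
by move=> vw; rewrite /psum !seriesEnat /=; apply: ler_sum => k _; case: insub.
Qed.

Lemma psum_ge0 v n : (forall i, 0 <= v i) -> 0 <= psum v n.
Proof.
by move=> v0; rewrite /psum seriesEnat /=; apply: sumr_ge0 => k _; case: insub.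
Qed.

Lemma psum_delta j a n :
  psum (fun i => if i == j then a else 0) n = if (val j < n)%N then a else 0.
Proof.
rewrite /psum seriesEnat /= (eq_bigr (fun k => if k == val j then a else 0)); last first.
  by move=> k _; case: insubP => [i _ <-|]; [rewrite -val_eqE|
    case: eqP => // ->; rewrite (valP j)].
rewrite -big_mkcond /= big_mkord; case: ifPn => [jn|jn]; last first.
  by rewrite big_pred0// => k; apply/eqP => kj; move: jn; rewrite -kj ltn_ord.
by rewrite (big_pred1 (Ordinal jn)).
Qed.

(** Only the entry at [j] can be negative, and a truncation contains it at most once. *)
Lemma psum_le_delta v j a n :
  (forall i, i != j -> 0 <= v i) -> - a <= v j -> 0 <= a -> - a <= psum v n.
Proof.
move=> v0 vj a0.
apply: (@le_trans _ _ (psum (fun i => if i == j then - a else 0) n)).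
  by rewrite psum_delta; case: ifP => // _; rewrite oppr_le0.
by apply: ler_psum => i; case: eqVneq => [->//|/v0].
Qed.

Lemma psum_cvg {I : Type} (F : set_system I) {FF : Filter F}
  (f : I -> state N -> R) v n :
  (forall i, f x i @[x --> F] --> v i) -> psum (f x) n @[x --> F] --> psum v n.
Proof.
move=> fv; elim: n => [|n IH].
  rewrite psum0 (_ : (fun x => psum (f x) 0) = cst 0); first exact: cvg_cst.
  by apply/funext => x; exact: psum0.
rewrite psumS (_ : (fun x => psum (f x) n.+1) = (fun x => psum (f x) n +
    (if (insub n : option (state N)) is Some i then f x i else 0))); last first.
  by apply/funext => x; exact: psumS.
by apply: cvgD => //; case: insub => //; exact: cvg_cst.
Qed.

Lemma has_sumD v w a s : has_sum v a -> has_sum w s -> has_sum (fun i => v i + w i) (a + s).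
Proof.
move=> va ws; rewrite has_sumE.
rewrite (_ : psum _ = psum v \+ psum w); last by apply/funext => n; rewrite psumD.
exact: cvgD.
Qed.

Lemma has_sumZ v a s : has_sum v s -> has_sum (fun i => a * v i) (a * s).
Proof.
move=> vs; rewrite has_sumE.
rewrite (_ : psum _ = (fun n => a * psum v n)); last by apply/funext => n; rewrite psumZ.
exact: cvgMr.
Qed.

Lemma has_sum_sum L (v : nat -> state N -> R) (s : nat -> R) :
  (forall l, has_sum (v l) (s l)) ->
  has_sum (fun i => \sum_(0 <= l < L) v l i) (\sum_(0 <= l < L) s l).
Proof.
move=> vs; elim: L => [|L IH]; last first.
  rewrite big_nat_recr//=; have := has_sumD IH (vs L).
  by congr has_sum; apply/funext => i; rewrite big_nat_recr.
rewrite big_geq // has_sumE (_ : psum _ = cst 0); first exact: cvg_cst.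
by apply/funext => n; rewrite psum_sum big_geq.
Qed.

Lemma psum_le_has_sum v s n : (forall i, 0 <= v i) -> has_sum v s -> psum v n <= s.
Proof.
move=> v0 vs; have <- : limn (psum v) = s by apply/cvg_lim.
apply: (nondecreasing_cvgn_le (u_ := psum v)); last by apply/cvg_ex; exists s.
move=> p q pq; rewrite /psum !seriesEnat /=; apply: nondecreasing_series => // k _ _.
by case: insub.
Qed.

(** Indices outside the state space contribute 0, so the unordered sum is a series of nonnegative
    terms over [nat], and its partial sums converge to it. *)
Lemma has_sum_esum v s : (forall i, 0 <= v i) ->
  \esum_(i in [set: state N]) (v i)%:E = s%:E -> has_sum v s.
Proof.
move=> v0 vs.
pose u k : R := if (insub k : option (state N)) is Some i then v i else 0.
have u0 k : (0 <= (u k)%:E)%E by rewrite lee_fin /u; case: insub.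
have us : (\sum_(0 <= k <oo) (u k)%:E)%E = s%:E.
  rewrite nneseries_esumT// -vs.
  rewrite [RHS](_ : _ = \esum_(i in [set: state N]) (u (val i))%:E); last first.
    by apply: eq_esum => i _; rewrite /u valK.
  rewrite -(reindex_esum [set: state N] [set k | below N k]
      (fun i : state N => val i) (fun k => (u k)%:E)).
    rewrite [RHS]esum_mkcond; apply: eq_esum => k _; case: ifPn => // /negP kN.
    by rewrite /u insubN//; apply/negP => kb; apply: kN; rewrite inE.
  split=> [i _|i j _ _|k /= kb]; [exact: valP|exact: val_inj|by exists (Sub k kb)].
have : (fun n => (\sum_(0 <= k < n) (u k)%:E)%E) @ \oo --> s%:E.
  by rewrite -us; apply: is_cvg_nneseries.
rewrite (_ : (fun n => _) = EFin \o psum v) => [|]; last first.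
  by apply/funext => n /=; rewrite sumEFin /psum seriesEnat.
by move/fine_cvg.
Qed.

End PartialSums.

(** * A potential bounded away from zero *)

Section Potential.
Context {R : realType} {N : option nat}.
Implicit Types (i j x : state N).

Lemma esum_delta (f : state N -> R) j : 0 <= f j ->
  \esum_(i in [set: state N]) (f i * (i == j)%:R)%:E = (f j)%:E.
Proof.
move=> fj; rewrite -(@esum_set1 _ _ j (fun i => (f i)%:E)) ?lee_fin// [RHS]esum_mkcond.
apply: eq_esum => i _; have -> : (i \in [set j]) = (i == j) by apply/idP/eqP; rewrite inE.
by case: eqVneq => [->|_]; rewrite ?mulr1 ?mulr0.
Qed.

(** Started from the point mass at [j], the coordinate at [x] alone is bounded by the total
    variation norm. Hence [p t x j] tends to [pi x] uniformly in [j], and eventually exceeds half of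
    it. *)
Lemma ergodic_lower_bound (A : state N -> state N -> R) (pi : state N -> R) x :
  uniformly_ergodic A pi -> 0 < pi x ->
  exists p, transition_function A p /\ exists T : nat, exists2 delta : R, 0 < delta &
    forall t j, T%:R <= t -> delta <= p t x j.
Proof.
move=> [_ [p [pA [C [rho [C0 rho0 cvg_p]]]]]] pix.
exists p; split => //.
(* From this time on exp (rho t) >= rho t >= 2 C / pi x, so the ergodic error is at most pi x /
   2. *)
pose T := Num.truncn (rho^-1 * (2 * C / pi x)).
exists T.+1, (pi x / 2); first by rewrite divr_gt0.
move=> t j Tt.
have t0 : 0 <= t by rewrite (le_trans _ Tt).
have p0 i : 0 <= p t i j by case: pA => /(_ t j t0)[].
have mu : prob_vector (fun i => (i == j)%:R : R).
  split => [i|]; first by rewrite ler0n.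
  rewrite -(@esum_delta (fun=> 1) j)//; apply: eq_esum => i _.
  by rewrite mul1r.
have pushE i : push (p t) (fun i => (i == j)%:R) i = p t i j.
  by rewrite /push (@esum_delta (fun k => p t i k))//=; case: pA => /(_ t j t0)[].
have : (`|p t x j - pi x|%:E <= (C * expR (- rho * t))%:E)%E.
  apply: le_trans (cvg_p t t0); apply: le_trans (ereal_sup_ubound _); last first.
    by exists (fun i => (i == j)%:R).
  rewrite /tv_norm -pushE.
  rewrite -(@esum_set1 _ _ x (fun i => `|push (p t) (fun i => (i == j)%:R) i - pi i|%:E))
      ?lee_fin//.
  rewrite esum_mkcond; apply: le_esum => i _; case: ifP => // _.
rewrite lee_fin => pxj.
suff : C * expR (- rho * t) <= pi x / 2 by move: pxj; rewrite ler_norml; lra.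
have ht : 2 * C / pi x <= expR (rho * t).
  apply: le_trans (expR_ge1Dx _).
  have Tt' : rho^-1 * (2 * C / pi x) <= t.
    by rewrite (le_trans _ Tt)// ltW// truncnS_gt.
  by move: Tt'; rewrite ler_pdivrMl//; lra.
rewrite mulNr expRN ler_pdivrMr ?expR_gt0//.
by move: ht; rewrite ler_pdivrMr//; lra.
Qed.

(* A Riemann sum of mesh h for the integral of exp (- c t) * p t x j dt. *)
Definition resolvent_sum (p : R -> state N -> state N -> R) c h L x (j : state N) : R :=
  h * \sum_(0 <= l < L) ((1 + c * h) ^- l * p (l%:R * h) x j).

Section ResolventSum.
Variables (A : state N -> state N -> R) (p : R -> state N -> state N -> R).
Hypothesis pA : transition_function A p.
Variables (c h : R) (L : nat) (x : state N).
Hypotheses (c0 : 0 < c) (h0 : 0 < h).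
Let phi := resolvent_sum p c h L x.

Lemma transition_ge0 t i j : 0 <= t -> 0 <= p t i j.
Proof. by move=> t0; case: pA => /(_ t j t0)[]. Qed.

Lemma transition_has_sum t j : 0 <= t -> has_sum (p t ^~ j) 1.
Proof.
by move=> t0; case: pA => /(_ t j t0)[_ p1] _ _ _;
    apply: has_sum_esum p1 => i; exact: transition_ge0.
Qed.

Lemma transition_le1 t i j : 0 <= t -> p t i j <= 1.
Proof.
move=> t0; have := psum_le_has_sum (val i).+1 (fun i => @transition_ge0 t i j t0)
    (transition_has_sum j t0).
apply: le_trans.
apply: (@le_trans _ _ (psum (fun k => if k == i then p t i j else 0) (val i).+1)).
  by rewrite psum_delta ltnSn.
by apply: ler_psum => k; case: eqVneq => [->//|_]; exact: transition_ge0.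
Qed.

Let r1 l : 0 <= (1 + c * h) ^- l :> R.
Proof. by rewrite invr_ge0 exprn_ge0// addr_ge0// mulr_ge0// ltW. Qed.

Let lh0 l : 0 <= l%:R * h. Proof. by rewrite mulr_ge0// ltW. Qed.

Lemma resolvent_sum_le j : phi j <= h * L%:R.
Proof.
rewrite ler_pM2l//; apply: (@le_trans _ _ (\sum_(0 <= l < L) 1)).
  apply: ler_sum => l _; apply: mulr_ile1; rewrite ?transition_ge0 ?transition_le1//.
  by rewrite invf_le1 ?exprn_ege1 ?exprn_gt0//; have := mulr_gt0 c0 h0; lra.
by rewrite big_const_nat subn0 iter_addr_0.
Qed.

(* Shifting the summation index by one step costs a factor 1 + c h and the
   term of index 0, which vanishes off x. *)
Lemma resolvent_sum_step j : j != x -> exists2 s,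
  has_sum (fun i => phi i * p h i j) s & (1 + c * h) * phi j <= s.
Proof.
move=> jx; exists (h * \sum_(0 <= l < L) ((1 + c * h) ^- l * p (l.+1%:R * h) x j)).
  have := @has_sum_sum _ _ L (fun l i => (1 + c * h) ^- l * (p (l%:R * h) x i * p h i j))
      (fun l => (1 + c * h) ^- l * p (l.+1%:R * h) x j).
  have pp l : has_sum (fun i => (1 + c * h) ^- l * (p (l%:R * h) x i * p h i j))
      ((1 + c * h) ^- l * p (l.+1%:R * h) x j).
    apply: has_sumZ; apply: has_sum_esum => [i|].
      by rewrite mulr_ge0// transition_ge0// ltW.
    by case: pA => _ _ -> //; [rewrite -natr1 mulrDl mul1r|exact: ltW].
  move/(_ pp)/(@has_sumZ _ _ _ h); congr has_sum; apply/funext => i.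
  rewrite /phi /resolvent_sum -mulrA mulr_suml; congr (_ * _).
  by apply: eq_bigr => l _; rewrite mulrA.
rewrite mulrCA ler_pM2l//.
have p0 : p 0 x j = 0 by case: pA => _ -> _ _; rewrite eq_sym (negPf jx).
have h1 : 1 + c * h != 0 by rewrite gt_eqF//; have := mulr_gt0 c0 h0; lra.
rewrite mulr_sumr.
case: L => [|K]; first by rewrite !big_geq.
rewrite big_nat_recl// mul0r p0 !mulr0 add0r [leRHS]big_nat_recr//=.
rewrite -[leLHS]addr0 lerD//; last by rewrite mulr_ge0// transition_ge0.
rewrite le_eqVlt; apply/orP; left; apply/eqP; apply: eq_bigr => l _.
by rewrite mulrA exprS invfM mulrA divff// mul1r.
Qed.

(** Summed over all i, the right side is (s - phi j) / h with s from [resolvent_sum_step], hence at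
    least c phi j. The terms left out by a truncation past j are (phi i - M) p h i j / h <= 0, so
    every such truncation is at least the full sum. *)
Lemma resolvent_sum_generator j M n : j != x -> (forall i, phi i <= M) -> (val j < n)%N ->
  c * phi j <= psum (fun i => (phi i - M) * (h^-1 * (p h i j - (i == j)%:R))) n.
Proof.
move=> jx phiM jn; have [s ss hs] := resolvent_sum_step jx.
have : psum (fun i => M * p h i j + -1 * (phi i * p h i j)) n <= M * 1 + -1 * s.
  apply: psum_le_has_sum => [i|].
    by have := mulr_ge0 (_ : 0 <= M - phi i) (transition_ge0 i j (ltW h0));
      rewrite subr_ge0 => /(_ (phiM i)); lra.
  by apply: has_sumD; apply: has_sumZ => //; apply: transition_has_sum; exact: ltW.
have -> : psum (fun i => (phi i - M) * (h^-1 * (p h i j - (i == j)%:R))) n =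
    - h^-1 * (psum (fun i => M * p h i j + -1 * (phi i * p h i j)) n - (M - phi j)).
  transitivity (- h^-1 * (psum (fun i => M * p h i j + -1 * (phi i * p h i j)) n
      + -1 * psum (fun i => if i == j then M - phi j else 0) n)).
    rewrite -psumZ -psumD -psumZ; congr psum; apply/funext => i.
    by case: eqVneq => [->|_]; rewrite ?mulr1n ?mulr0n; lra.
  by rewrite psum_delta jn mulN1r.
move=> H; rewrite mulNr -mulrN ler_pdivlMl//; lra.
Qed.

End ResolventSum.

(** Compactness of the segment gives a cluster point; an ultrafilter contains the preimage of each
    of its neighbourhoods or of the complement, and the latter contradicts clustering. *)
Lemma ultra_bounded_cvg {I : Type} (U : set_system I) {UU : UltraFilter U} (f : I -> R) a b :
  (forall q, a <= f q <= b) -> exists l : R, f q @[q --> U] --> l.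
Proof.
move=> fab.
have [l [_ cl]] : `[a, b]%classic `&` cluster (f q @[q --> U]) !=set0.
  apply: segment_compact; apply: (@filterS _ U) filterT => q _.
  by rewrite /= in_itv/=; exact: fab.
exists l => B Bl.
have [//|UB] := in_ultra_setVsetC (f @^-1` B) UU.
by have [r []] := cl (~` B) B UB Bl.
Qed.

Lemma transition_cvg A p i j : @transition_function R N A p ->
  (q.+1%:R * (p (q.+1%:R^-1) i j - (i == j)%:R)) @[q --> \oo] --> A i j.
Proof.
move=> [_ _ _ /(_ i j)] pA.
have hq : (q.+1%:R^-1 : R) @[q --> \oo] --> (0 : R) := cvg_harmonic.
move/cvg_at_rightP : pA => /(_ (fun q => q.+1%:R^-1)) pA.
have := pA (conj _ hq);
    rewrite (_ : (fun q => _) = (fun q => q.+1%:R * (p (q.+1%:R^-1) i j - (i == j)%:R))).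
  by apply => q; rewrite invr_gt0.
by apply/funext => q; rewrite invrK.
Qed.

Lemma exists_potential A pi x c : @rate_matrix R N A -> uniformly_ergodic A pi ->
  0 < pi x -> 0 < c ->
  exists psi : state N -> R, exists m M, [/\ 0 < m, forall j, m <= psi j <= M &
    forall j, j != x -> forall e, 0 < e ->
      \forall n \near \oo, c * psi j - e <= psum (fun i => psi i * A i j) n].
Proof.
move=> [_ A0 _] erg pix c0.
have [p [pA [T [delta delta0 pT]]]] := ergodic_lower_bound erg pix.
(* Mesh 1 / (q + 1) with enough terms to cover the time span T + 1. Since p <= 1, this span is the
   upper bound [M]. *)
pose h q : R := q.+1%:R^-1; pose L q := (T.+1 * q.+1)%N.
pose phi q := resolvent_sum p c (h q) (L q) x.
pose M : R := T.+1%:R; pose m := delta * expR (- (c * T.+1%:R)).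
have h0 q : 0 < h q by rewrite invr_gt0.
have hL q : h q * (L q)%:R = M.
  by rewrite /h /L natrM mulrCA mulVf ?mulr1// pnatr_eq0.
have phiM q j : phi q j <= M by rewrite -(hL q); exact: (resolvent_sum_le pA).
have phim q j : m <= phi q j.
  have cL l : (l <= L q)%N -> expR (- (c * T.+1%:R)) <= (1 + c * h q) ^- l.
    move=> lL; rewrite expRN lef_pV2 ?posrE ?expR_gt0 ?exprn_gt0//; last first.
      by have := mulr_gt0 c0 (h0 q); lra.
    apply: (@le_trans _ _ (expR (c * h q) ^+ l)).
      apply: lerXn2r; rewrite ?nnegrE ?expR_ge0 ?expR_ge1Dx//.
      by have := mulr_gt0 c0 (h0 q); lra.
    rewrite -expRM_natl ler_expR mulrCA ler_pM2l// -/M -(hL q) mulrC ler_pM2l//.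
    by rewrite ler_nat.
  (* The lower bound uses only the last unit of time, from T to T + 1: there p >= delta and the
     discount is at least exp (- c (T + 1)). *)
  have Th : m <= h q * \sum_(T * q.+1 <= l < L q) m.
    rewrite sumr_const_nat /L mulSn addnK -[m *+ _]mulr_natr mulrCA.
    by rewrite /h mulVf ?mulr1// pnatr_eq0.
  apply: (le_trans Th); rewrite ler_pM2l//.
  rewrite [leRHS](big_cat_nat _ (n := (T * q.+1)%N))//=; last
    by rewrite leq_mul2r leqnSn orbT.
  rewrite -[leLHS]add0r lerD//.
    apply: sumr_ge0 => l _; rewrite mulr_ge0 ?(transition_ge0 pA)//.
      by rewrite invr_ge0 exprn_ge0//; have := mulr_gt0 c0 (h0 q); lra.
    by rewrite mulr_ge0// ltW.
  rewrite !big_nat; apply: ler_sum => l /andP[Tl lL].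
  rewrite /m mulrC ler_pM ?expR_ge0 ?(ltW delta0) ?(cL l (ltnW lL))//.
  by apply: pT; rewrite /h ler_pdivlMr// -natrM ler_nat.
(* As the mesh tends to 0 the Riemann sums need not be known to converge:
   a limit along an ultrafilter is enough. *)
have [U [UU Uoo]] := @ultraFilterLemma nat \oo _.
have /choice[psi psiE] j : exists l : R, phi q j @[q --> U] --> l.
  by apply: (@ultra_bounded_cvg _ U _ _ m M) => q; rewrite phim phiM.
exists psi, m, M; split.
- by rewrite mulr_gt0 ?expR_gt0.
- move=> j; apply/andP; split.
    by apply: cvgr_to_ge (psiE j) _; near=> q; exact: phim.
  by apply: cvgr_to_le (psiE j) _; near=> q; exact: phiM.
move=> j jx e e0.
have lim_n n : (val j < n)%N -> c * psi j <= psum (fun i => (psi i - M) * A i j) n.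
  (* The factor psi - M, of constant sign, makes the partial sums one-sided
     bounds; the extra term M * A i j sums to 0 over i. *)
  move=> jn.
  have cl : c * phi q j @[q --> U] --> c * psi j by apply: cvgMr.
  have cr : psum (fun i => (phi q i - M) * ((h q)^-1 * (p (h q) i j - (i == j)%:R))) n @[q --> U]
     --> psum (fun i => (psi i - M) * A i j) n.
    apply: psum_cvg => i; apply: cvgM.
      by apply: cvgB => //; exact: cvg_cst.
    move=> B /(transition_cvg (i := i) (j := j) pA) hB; apply: Uoo; move: hB.
    by congr (\oo _); apply/funext => q; rewrite /= /h invrK.
  apply: (ler_cvg_to cl cr); near=> q.
  exact: (resolvent_sum_generator pA c0 (h0 q) jx (phiM q) jn).
(* Returning from psi - M to psi adds M times a truncated column sum of A, which is eventually above
   - e. *)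
have e0' : 0 < e / M by rewrite divr_gt0// ltr0n.
have /cvgrPdist_lt/(_ _ e0') A0j : psum (A ^~ j) @ \oo --> 0 := A0 j.
near=> n.
have jn : (val j < n)%N by near: n; exact: nbhs_infty_gt.
have := lim_n n jn.
have -> : psum (fun i => (psi i - M) * A i j) n =
    psum (fun i => psi i * A i j) n - M * psum (A ^~ j) n.
  rewrite -mulNr -psumZ -psumD.
  by congr psum; apply/funext => i; rewrite mulrBl mulNr.
have : - e <= M * psum (A ^~ j) n.
  rewrite -ler_pdivrMl ?ltr0n//.
  have : `|0 - psum (A ^~ j) n| < e / M by near: n; exact: A0j.
  by rewrite sub0r normrN ltr_norml mulrN mulrC => /andP[/ltW].
lra.
Unshelve. all: by end_near.
Qed.

End Potential.

(** * Rates and drift of the potential *)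

Lemma limn_einf_ge {R : realType} (u : nat -> R) a :
  (forall e, 0 < e -> \forall n \near \oo, a - e <= u n) ->
  (a%:E <= limn_einf (EFin \o u))%E.
Proof.
move=> au; apply/lee_subgt0Pr => e e0.
have [n0 _ n0u] := au e e0.
rewrite limn_einf_lim.
apply: (@le_trans _ _ (einfs (EFin \o u) n0)).
  by apply: le_ereal_inf_tmp => _ [k /= n0k <-]; rewrite lee_fin; exact: n0u.
rewrite (cvg_lim _ (@cvg_einfs_sup _ _))//.
by apply: ereal_sup_ubound; exists n0.
Qed.

Lemma le_limn_einf {R : realType} (u v : nat -> \bar R) :
  (forall n, u n <= v n)%E -> (limn_einf u <= limn_einf v)%E.
Proof.
move=> uv; rewrite !limn_einf_lim; apply: lee_lim; [exact: is_cvg_einfs..|].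
near=> n; apply: le_ereal_inf_tmp => _ [k nk <-].
by apply: le_trans (uv k); apply: ereal_inf_lbound; exists k.
Unshelve. all: by end_near.
Qed.

Section Ratio.
Context {R : realType}.
Implicit Types (a b g K : R).

(** Clearing the denominator reverses the bounds when b < 0, as happens on the diagonal of a rate
    matrix. When b = 0, the finite upper bound excludes the value [+oo] and forces a = 0. *)
Lemma ratio_bounds g a b : 0 < g ->
  (g%:E <= ratio a b <= (g^-1)%:E)%E ->
  (0 <= b -> g * b <= a <= g^-1 * b) /\ (b <= 0 -> g^-1 * b <= a <= g * b).
Proof.
move=> g0; rewrite /ratio; case: eqVneq => [->|b0].
  by case: eqVneq => [->|_]; rewrite !mulr0 ?lexx// leye_eq andbF.
rewrite !lee_fin => /andP[ga ag]; split => bs.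
  have b1 : 0 < b by rewrite lt_neqAle eq_sym b0.
  by rewrite -ler_pdivlMr// ga -ler_pdivrMr.
have b1 : b < 0 by rewrite lt_neqAle b0.
by rewrite -ler_ndivrMr// ag -ler_ndivlMr.
Qed.

Lemma ratio_norm g a b K : 0 < g -> `|b| <= K ->
  (g%:E <= ratio a b <= (g^-1)%:E)%E -> `|a| <= g^-1 * K.
Proof.
move=> g0 bK /(ratio_bounds g0)[pos neg].
have gV0 : 0 < g^-1 by rewrite invr_gt0.
rewrite (@le_trans _ _ (g^-1 * `|b|)) ?ler_pM2l//.
have [b0|b0] := leP 0 b.
  have /andP[l r] := pos b0; rewrite (ger0_norm b0) ger0_norm//.
  by rewrite (le_trans _ l)// mulr_ge0// ltW.
have /andP[l r] := neg (ltW b0); rewrite (ltr0_norm b0) ler0_norm ?mulrN ?lerN2//.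
by rewrite (le_trans r)// mulr_ge0_le0// ltW.
Qed.

(** Meant for diagonal entries: it gives them the same factor g as the off-diagonal ones, at the
    price of one bounded term. *)
Lemma ratio_ge g a b K : 0 < g -> `|b| <= K ->
  (g%:E <= ratio a b <= (g^-1)%:E)%E -> g * b - g^-1 * K <= a.
Proof.
move=> g0 bK r; have [pos neg] := ratio_bounds g0 r.
have gV0 : 0 < g^-1 by rewrite invr_gt0.
have K0 : 0 <= g^-1 * K by rewrite mulr_ge0 ?(le_trans _ bK)// ltW.
have [b0|b0] := leP 0 b; first by have /andP[] := pos b0; lra.
have := ratio_norm g0 bK r; rewrite ler_norml => /andP[l _].
by have : g * b <= 0; [rewrite mulr_ge0_le0// ltW|lra].
Qed.

End Ratio.

(** The sets whose section at [w] is Borel form a sigma-algebra, and the sections of the generators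
    are empty, a point or an interval. This makes the pathwise time integrals of the compensator
    tractable. *)
Lemma predictable_section {R : realType} {Omega : Type}
    (Fl : R -> set (set Omega)) (l : R -> Omega -> R) (w : Omega) :
  predictable Fl l -> measurable_fun (`[0, +oo[%classic : set R) (fun u : R => l u w).
Proof.
move=> pl _ Y mY.
have : predictable_sets Fl `<=` [set E | measurable [set u : R | 0 <= u /\ E (u, w)]].
  apply: smallest_sub; last first.
    move=> E [[B _ ->]|[s [t [B [s0 _ _ ->]]]]] /=.
    - have [Bw|Bw] := pselect (B w).
        rewrite (_ : mkset _ = [set 0])//; apply/seteqP; split => [u []|u ->]//=.
        by move=> _ [].
      by rewrite (_ : mkset _ = set0)//; apply/seteqP; split => [u [] _ []|u].
    - have [Bw|Bw] := pselect (B w).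
        rewrite (_ : mkset _ = `]s, t]%classic)//; apply/seteqP; split => [u [] _ []|u]//= ut.
        by split => //; move: ut; rewrite in_itv/= => /andP[/ltW su _]; exact: le_trans su.
      by rewrite (_ : mkset _ = set0)//; apply/seteqP; split => [u [] _ []|u].
  split => /=.
  - by rewrite (_ : mkset _ = set0)//; apply/seteqP; split => [u []|u].
  - move=> E mE.
    rewrite (_ : mkset _ = `[0, +oo[%classic `\` [set u | 0 <= u /\ E (u, w)]);
        first exact: measurableD.
    apply/seteqP; split => u /=; rewrite in_itv/= andbT.
      by move=> [u0 [_ nE]]; split => // -[].
    by move=> [u0 nE]; split => //; split; [split => //; rewrite in_itv/= u0|move=> Eu; exact: nE].
  - move=> E mE.
    rewrite (_ : mkset _ = \bigcup_k [set u | 0 <= u /\ E k (u, w)]);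
        first exact: bigcup_measurable.
    by apply/seteqP; split => u /=; [move=> [u0 [k _ Ek]]; exists k|
        move=> [k _ [u0 Ek]]; split => //; exists k].
move=> /(_ _ (pl Y mY)) /=; congr measurable; apply/seteqP; split => u /=; rewrite in_itv/= andbT.
  by move=> [u0 []].
by move=> [].
Qed.

(** * Fatou's lemma and integrals of truncated sums *)

Section Measure.
Context {R : realType} {d : measure_display} {T : measurableType d}.
Variable mu : {measure set T -> \bar R}.

(** Fatou's lemma on [D], after which the integral of the liminf is restricted to [E]. It is applied
    once in time along a path, and once on the probability space. *)
Lemma fatou_lower_bound (D E : set T) (f : nat -> T -> R) a :
  measurable D -> measurable E -> E `<=` D ->
  (forall n, measurable_fun D (f n)) -> (forall n x, D x -> 0 <= f n x) ->
  0 <= a -> (forall x, E x -> (a%:E <= limn_einf (fun n => (f n x)%:E))%E) ->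
  (a%:E * mu E <= limn_einf (fun n => \int[mu]_(x in D) (f n x)%:E))%E.
Proof.
move=> mD mE ED mf f0 a0 af.
have mF n : measurable_fun D (fun x => (f n x)%:E) by exact/measurable_EFinP.
have mlim : measurable_fun D (fun x => limn_einf (fun n => (f n x)%:E)).
  apply: (emeasurable_fun_cvg (fun n x => einfs (fun n => (f n x)%:E) n)).
    by move=> n; exact: measurable_fun_einfs.
  by move=> x Dx; rewrite limn_einf_lim; exact: is_cvg_einfs.
have lim0 x : D x -> (0 <= limn_einf (fun n => (f n x)%:E))%E.
  move=> Dx; apply: (@limn_einf_ge _ (fun n => f n x)) => e e0.
  by near=> n; rewrite sub0r (le_trans _ (f0 n x Dx))// oppr_le0 ltW.
apply: le_trans (fatou mu mD mF _); last by move=> n x Dx; rewrite lee_fin f0.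
apply: (@le_trans _ _ (\int[mu]_(x in E) limn_einf (fun n => (f n x)%:E))%E); last first.
  exact: ge0_subset_integral.
rewrite -integral_cst//; apply: ge0_le_integral => //.
by apply: measurable_funS mlim.
Unshelve. all: by end_near.
Qed.

Lemma integral_cst_sub (D : set T) (f h : T -> R) c :
  measurable D -> (mu D < +oo)%E ->
  mu.-integrable D (EFin \o f) -> mu.-integrable D (EFin \o h) ->
  \int[mu]_(x in D) f x = \int[mu]_(x in D) h x ->
  (\int[mu]_(x in D) (c - (f x - h x))%:E = c%:E * mu D)%E.
Proof.
move=> mD Doo fi hi fh.
have fhE : (\int[mu]_(x in D) (EFin \o f) x = \int[mu]_(x in D) (EFin \o h) x)%E.
  by have := congr1 EFin fh; rewrite /Rintegral !fineK//; exact: integrable_fin_num.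
have ci : mu.-integrable D (EFin \o cst c).
  by apply: measurable_bounded_integrable => //; exact: bounded_cst.
rewrite (_ : (fun x => _) = (fun x => (EFin \o cst c) x -
    ((EFin \o f) x - (EFin \o h) x))%E); last by apply/funext => x; rewrite /= -!EFinB.
rewrite integralB//; last exact: integrableB.
rewrite integralB// fhE subee ?(integrable_fin_num mD hi)// sube0.
exact: (integral_cst mu mD c%:E).
Qed.

Lemma integrable_psum {N : option nat} (D : set T) (f : T -> state N -> R) n :
  measurable D -> (forall i, mu.-integrable D (EFin \o f ^~ i)) ->
  mu.-integrable D (EFin \o (fun x => psum (f x) n)) /\
  \int[mu]_(x in D) psum (f x) n = psum (fun i => \int[mu]_(x in D) f x i) n.
Proof.
move=> mD fi; elim: n => [|n [IHi IH]].
  rewrite psum0 (_ : (fun x => psum (f x) 0) = cst 0); last first.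
    by apply/funext => x; exact: psum0.
  by split; [exact: integrable0|rewrite Rintegral_cst// mul0r].
rewrite psumS (_ : (fun x => psum (f x) n.+1) = (fun x => psum (f x) n +
    (if (insub n : option (state N)) is Some i then f x i else 0))); last first.
  by apply/funext => x; exact: psumS.
case: insub => [i|].
  by split; [exact: (integrableD mD IHi (fi i))|rewrite RintegralD// IH].
rewrite addr0 -IH; split; last by apply: eq_Rintegral => x _; rewrite addr0.
by apply: eq_integrable IHi => // x _ /=; rewrite addr0.
Qed.

End Measure.

(** * Drift of the potential along a fixed path *)

Section Drift.
Context {R : realType} {N : option nat}.
Variables (A : state N -> state N -> R) (g K m M : R) (xhat : state N).
Variable psi : state N -> R.
Hypotheses (Aoff : forall i j, i != j -> 0 <= A i j)
  (AK : forall i j, `|A i j| <= K) (g0 : 0 < g) (m0 : 0 < m).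
Hypothesis psimM : forall j, m <= psi j <= M.
Hypothesis psi_drift : forall j, j != xhat -> forall e, 0 < e ->
  \forall n \near \oo,
    (g^-1 * (g^-1 * K + 1)) * psi j - e <= psum (fun i => psi i * A i j) n.

Variables (x : R -> state N) (l : R -> state N -> R).
Hypothesis xpj : pure_jump x.
Hypothesis lmeas : forall i, measurable_fun (`[0, +oo[%classic : set R) (l ^~ i).
Hypothesis lratio : forall t i j, 0 <= t -> left_limit x t j ->
  (g%:E <= ratio (l t i) (A i j) <= (g^-1)%:E)%E.

Let C := g^-1 * K * M.

Let gV0 : 0 < g^-1. Proof. by rewrite invr_gt0. Qed.
Let K0 : 0 <= K. Proof. by rewrite (le_trans _ (AK xhat xhat)). Qed.
Let psi0 j : 0 <= psi j. Proof. by have /andP[+ _] := psimM j; apply/le_trans/ltW. Qed.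
Let psiM j : psi j <= M. Proof. by have /andP[] := psimM j. Qed.
Let M0 : 0 <= M. Proof. exact: le_trans (psi0 xhat) (psiM xhat). Qed.
Let C0 : 0 <= C. Proof. by rewrite !mulr_ge0// ltW. Qed.

Let rate_norm t i : 0 <= t -> `|l t i| <= g^-1 * K.
Proof.
move=> t0; have [_ /(_ t t0)[j tj]] := xpj.
exact: ratio_norm g0 (AK i j) (lratio i t0 tj).
Qed.

Let drift t n := psum (fun i => psi i * l t i) n.

(** Only the rate at the current state can be negative; it is at least - K / g, and psi <= M. Adding
    [C] thus makes the integrands nonnegative, as Fatou's lemma requires. *)
Lemma drift_ge t n : 0 <= t -> - C <= drift t n.
Proof.
move=> t0; have [_ /(_ t t0)[j tj]] := xpj.
apply: (psum_le_delta (j := j)) => // [i ij|].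
  have [/(_ (Aoff ij))/andP[+ _] _] := ratio_bounds g0 (lratio i t0 tj).
  by move=> li; rewrite mulr_ge0// (le_trans _ li)// mulr_ge0 ?Aoff// ltW.
have := rate_norm j t0; rewrite ler_norml => /andP[lj _].
rewrite /C mulrC; apply: (@le_trans _ _ (psi j * - (g^-1 * K))); last by rewrite ler_wpM2l.
by rewrite mulrN lerN2 ler_wpM2r// mulr_ge0// ltW.
Qed.

(** Off the diagonal l >= g A, and on it l >= g A - K / g, so the drift is at least g times that of
    A minus (K / g) psi j. The constant in [psi_drift] is chosen so that psi j >= m is what
    remains. *)
Lemma drift_liminf t j : 0 <= t -> left_limit x t j -> j != xhat ->
  forall e, 0 < e -> \forall n \near \oo, m - e <= drift t n.
Proof.
move=> t0 tj jx e e0.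
have e0' : 0 < g^-1 * e by rewrite mulr_gt0.
have := psi_drift jx e0'; apply: filterS => n dn.
apply: (@le_trans _ _ (g * psum (fun i => psi i * A i j) n - g^-1 * K * psi j)).
  have : g * (g^-1 * (g^-1 * K + 1) * psi j - g^-1 * e) <= g * psum (fun i => psi i * A i j) n.
    by rewrite ler_pM2l.
  have -> : g * (g^-1 * (g^-1 * K + 1) * psi j - g^-1 * e) = (g^-1 * K + 1) * psi j - e.
    by rewrite mulrBr !mulrA divff ?gt_eqF// !mul1r.
  by have /andP[] := psimM j; lra.
apply: (@le_trans _ _ (g * psum (fun i => psi i * A i j) n +
    psum (fun i => if i == j then - (g^-1 * K * psi j) else 0) n)).
  rewrite lerD2l psum_delta; case: ifP => // _.
  by rewrite oppr_le0 !mulr_ge0// ltW.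
rewrite -psumZ -psumD; apply: ler_psum => i.
have := ratio_bounds g0 (lratio i t0 tj); case: eqVneq => [-> _|ij].
  have : psi j * (g * A j j - g^-1 * K) <= psi j * l t j.
    by rewrite ler_wpM2l//; exact: ratio_ge g0 (AK j j) (lratio j t0 tj).
  lra.
move=> [/(_ (Aoff ij))/andP[+ _] _] => li.
by have : psi i * (g * A i j) <= psi i * l t i; [rewrite ler_wpM2l|lra].
Qed.

Section Interval.
Variables s t : R.
Hypotheses (s0 : 0 <= s) (st : s <= t).

Lemma rate_integrable i r : lebesgue_measure.-integrable (`]0, r] : set R) (EFin \o l ^~ i).
Proof.
apply: measurable_bounded_integrable => //.
- by rewrite /= lebesgue_measure_itv/=; case: ifP => // _; rewrite -EFinD ltry.
- by apply: measurable_funS (lmeas i) => // u/=; rewrite !in_itv/= andbT => /andP[/ltW].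
- exists (g^-1 * K); split; first exact: num_real.
  move=> y Ky u /=; rewrite in_itv/= => /andP[u0 _].
  by apply: le_trans (ltW Ky); exact/rate_norm/ltW.
Qed.

Let sub : (`]s, t] : set R) `<=` `]0, t].
Proof. by move=> u/=; rewrite !in_itv/= => /andP[su ->]; rewrite (le_lt_trans s0 su). Qed.

Let rate_integrable_st i : lebesgue_measure.-integrable (`]s, t] : set R) (EFin \o l ^~ i).
Proof. by apply: integrableS (rate_integrable i t). Qed.

Let term_integrable i :
  lebesgue_measure.-integrable (`]s, t] : set R) (EFin \o (fun u => psi i * l u i)).
Proof.
by apply: (eq_integrable _ _ _ _ (integrableZl _ (psi i) (rate_integrable_st i))).
Qed.

Let drift_integrable n : lebesgue_measure.-integrable (`]s, t] : set R) (EFin \o drift ^~ n).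
Proof.
have [//|H _] := @integrable_psum _ _ _ _ N _ (fun (u : measurableTypeR R) i => psi i * l u i)
    n _ term_integrable.
exact: H.
Qed.

Let J n := psum (fun i => psi i * (\int[lebesgue_measure]_(u in `]0, t]) l u i
                                 - \int[lebesgue_measure]_(u in `]0, s]) l u i)) n.

Let drift_integralE n : J n = \int[lebesgue_measure]_(u in `]s, t]) drift u n.
Proof.
have [//|_ H] := @integrable_psum _ _ _ _ N _ (fun (u : measurableTypeR R) i => psi i * l u i)
    n _ term_integrable.
rewrite [RHS]H.
congr psum; apply/funext => i.
by rewrite Rintegral_itvB ?RintegralZl//; exact: rate_integrable.
Qed.

Let mu_st : lebesgue_measure (`]s, t] : set R) = (t - s)%:E.
Proof.
rewrite lebesgue_measure_itv/= lte_fin; case: ltP => // ts.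
by have -> : t = s by [apply/eqP; rewrite eq_le ts]; rewrite subrr.
Qed.

Let JE n : (\int[lebesgue_measure]_(u in `]s, t]) (drift u n + C)%:E)%E
  = (J n + C * (t - s))%:E.
Proof.
under eq_integral do rewrite EFinD.
have dn : lebesgue_measure.-integrable (`]s, t] : set R) (fun u => (drift u n)%:E).
  exact: drift_integrable.
have Cn : lebesgue_measure.-integrable (`]s, t] : set R) (fun=> C%:E).
  apply: (@measurable_bounded_integrable _ _ _ _ (cst C)) => //.
    by rewrite /= mu_st ltry.
  exact: bounded_cst.
rewrite (integralD _ dn Cn)//=.
rewrite [X in (_ + X)%E](_ : _ = (C * (t - s))%:E); last first.
  by have := integral_cst lebesgue_measure (measurable_itv `]s, t]) C%:E; rewrite /= mu_st.
rewrite EFinD; congr (_ + _)%E.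
by rewrite drift_integralE /Rintegral fineK//; exact: integrable_fin_num.
Qed.

Lemma drift_integral_ge n : 0 <= J n + C * (t - s).
Proof.
rewrite -lee_fin -JE; apply: integral_ge0 => u; rewrite /= in_itv/= => /andP[su _].
by have := drift_ge n (le_trans s0 (ltW su)); rewrite lee_fin; lra.
Qed.

(** Fatou's lemma in time, applied to the drift plus [C]: at each u in ]s, t] the state just before
    u differs from [xhat], so [drift_liminf] bounds the integrand pointwise. *)
Lemma drift_integral_liminf : (forall u, 0 <= u -> u <= t -> x u != xhat) ->
  (((m + C) * (t - s))%:E <= limn_einf (fun n => (J n + C * (t - s))%:E))%E.
Proof.
move=> nohit; under [X in limn_einf X]funext do rewrite -JE.
rewrite EFinM -mu_st; apply: fatou_lower_bound => //.
- move=> n; apply: measurable_funD => //.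
  by have /integrableP[/measurable_EFinP] := drift_integrable n.
- move=> n u; rewrite /= in_itv/= => /andP[su _].
  by have := drift_ge n (le_trans s0 (ltW su)); lra.
- by rewrite addr_ge0// ltW.
move=> u; rewrite /= in_itv/= => /andP[su ut].
have u0 : 0 <= u := le_trans s0 (ltW su).
have [_ /(_ u u0)[j uj]] := xpj.
have jx : j != xhat.
  move: uj; rewrite /left_limit gt_eqF ?(le_lt_trans s0 su)// => uj.
  (* As u > 0, the left limit is a value actually taken by the path in ]s, u[, where [xhat] is
     avoided. *)
  have [v []] : exists v, x v = j /\ s < v < u.
    near (u^'-) => v; exists v; split; first by near: v.
    by apply/andP; split; near: v; [exact: nbhs_left_gt|exact: nbhs_left_lt].
  move=> <- /andP[sv vu]; apply: nohit; first by rewrite (le_trans s0)// ltW.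
  by rewrite (le_trans (ltW vu)).
apply: (@limn_einf_ge _ (fun n => drift u n + C)) => e e0.
by have := drift_liminf u0 uj jx e0; apply: filterS => n; lra.
Unshelve. all: by end_near.
Qed.

End Interval.
End Drift.

(** * Avoiding a state under a controlled measure *)

(** Avoidance is counted from time 0, like [hitting_time]: a path that hits before t leaves the
    event, in accordance with the positive part of tau - t. *)
Definition not_hit {R : realType} {N : option nat} {Omega : Type}
  (X : R -> Omega -> state N) (x : state N) (r : R) : set Omega :=
  [set w | forall u, 0 <= u -> u <= r -> X u w != x].

Section Filtration.
Context {R : realType} {N : option nat} {d : measure_display}
  {Omega : measurableType d}.
Variables (P : probability Omega R) (X : R -> Omega -> state N).

Lemma filt_preimage s t i : 0 <= s -> s <= t -> filt P X t (X s @^-1` [set i]).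
Proof.
move=> s0 st; apply: sub_gen_smallest; left; apply: sub_gen_smallest.
by exists s; [rewrite /= in_itv/= s0|exists i].
Qed.

Lemma sigma_of_subset (S S' : set R) : S `<=` S' -> sigma_of X S `<=` sigma_of X S'.
Proof.
move=> SS'; apply: sub_smallest2r; first exact: smallest_sigma_algebra.
by move=> B [s Ss [i ->]]; exists s; [exact: SS'|exists i].
Qed.

Lemma completed_subset (S S' : set R) : S `<=` S' -> completed P X S `<=` completed P X S'.
Proof.
move=> SS'; apply: sub_smallest2r; first exact: smallest_sigma_algebra.
by apply: setSU; exact: sigma_of_subset.
Qed.

Lemma filt_subset s t : s <= t -> filt P X s `<=` filt P X t.
Proof.
move=> st; apply: completed_subset => u /=; rewrite !in_itv/= => /andP[-> us].
exact: le_trans st.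
Qed.

Lemma filt_setI t B B' : filt P X t B -> filt P X t B' -> filt P X t (B `&` B').
Proof. exact: (@measurableI _ (g_sigma_algebraType _)). Qed.

Lemma filt_not_hit x r : (forall w, pure_jump (X ^~ w)) -> 0 <= r ->
  filt P X r (not_hit X x r).
Proof.
move=> pj r0.
(* Enumerates the rationals of [0, r], with default value r. By right continuity a visit before r is
   also seen at a later rational time. *)
pose time n : R := if (unpickle n : option rat) is Some q then
  (if (0 <= (ratr q : R) <= r) then ratr q else r) else r.
have time_itv n : 0 <= time n <= r.
  rewrite /time; case: unpickle => [q|]; last by rewrite r0 lexx.
  by have [-> //|_] := boolP ((0 <= (ratr q : R)) && (ratr q <= r)); rewrite r0 lexx.
suff -> : not_hit X x r = ~` \bigcup_n (X (time n) @^-1` [set x]).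
  apply: sigma_algebraC; apply: sigma_algebra_bigcup => n.
  by have /andP[] := time_itv n; exact: filt_preimage.
apply/seteqP; split => w.
  move=> nh [n _ /= tx]; have /andP[n0 nr] := time_itv n.
  by have := nh _ n0 nr; rewrite tx eqxx.
move=> nh u u0; rewrite le_eqVlt => /predU1P[->|ur].
  (* The rational -1 lies outside [0, r], so its code yields the default time r. *)
  apply/eqP => ux; apply: nh; exists (pickle (-1 : rat)) => //=.
  rewrite /time pickleK; case: ifP => // /andP[].
  by rewrite rmorphN1 oppr_ge0 ler10.
apply/eqP => ux; apply: nh.
have [/(_ u u0) [e /= e0 He] _] := pj w.
have [q] : exists q, ratr q \in `]u, Num.min r (u + e)[.
  by apply: rat_in_itvoo; rewrite lt_min ur ltrDl.
rewrite in_itv/= lt_min => /and3P[uq qr qe].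
exists (pickle q) => //=.
rewrite /time pickleK (le_trans u0 (ltW uq)) (ltW qr)/= -ux.
by apply: He => //=; rewrite ltr0_norm ?subr_lt0//; lra.
Qed.

End Filtration.

(** The integral of a nonnegative function is a supremum over the simple functions below it, and
    these only increase in number. It serves for the exponential of the hitting time, of which only
    pointwise bounds are used. *)
Lemma ge0_le_integral_nonmeasurable {R : realType} {d} {T : measurableType d}
  (mu : {measure set T -> \bar R}) (D : set T) (f h : T -> \bar R) :
  (forall x, D x -> (0 <= f x)%E) -> (forall x, D x -> (f x <= h x)%E) ->
  (\int[mu]_(x in D) f x <= \int[mu]_(x in D) h x)%E.
Proof.
move=> f0 fh; rewrite !ge0_integralE//; last by move=> x Dx; exact: le_trans (f0 x Dx) (fh x Dx).
apply: ereal_sup_le => _ [k kf <-]; exists k => // x.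
by apply: le_trans (kf x) _; apply: lee_restrict.
Qed.

(** * Avoidance over one time window, and its iteration *)

Section OneStep.
Context {R : realType} {N : option nat}.
Variables (A : state N -> state N -> R) (g K m M : R) (xhat : state N).
Variable psi : state N -> R.
Hypotheses (Aoff : forall i j, i != j -> 0 <= A i j)
  (AK : forall i j, `|A i j| <= K) (g0 : 0 < g) (m0 : 0 < m).
Hypothesis psimM : forall j, m <= psi j <= M.
Hypothesis psi_drift : forall j, j != xhat -> forall e, 0 < e ->
  \forall n \near \oo,
    (g^-1 * (g^-1 * K + 1)) * psi j - e <= psum (fun i => psi i * A i j) n.

Context {d : measure_display} {Omega : measurableType d}.
Variables (P : probability Omega R) (X : R -> Omega -> state N).
Hypothesis Xpj : forall w, pure_jump (X ^~ w).
Hypothesis measE : (measurable : set (set Omega)) = filt_oo P X.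
Variable Q : probability Omega R.
Hypothesis QP : Qgamma P X A g Q.

Let C := g^-1 * K * M.

Lemma filt_measurable t (F : set Omega) : filt P X t F -> measurable F.
Proof.
rewrite measE; apply: completed_subset => u /=; rewrite !in_itv/= => /andP[-> _].
by [].
Qed.

(** By the martingale property the mean drift integral over F equals the mean gain of psi(X), at
    most M Q(F), up to truncation. With C (t - s) added, the integrand is nonnegative, and its
    liminf is at least (m + C) (t - s) where [xhat] is avoided. *)
Lemma no_hit_step s t F : 0 <= s -> s <= t -> filt P X s F ->
  (((m + C) * (t - s))%:E * Q (F `&` not_hit X xhat t)
    <= (M + C * (t - s))%:E * Q F)%E.
Proof.
move=> s0 st sF; have [lam [lpred _ lratio lmart]] := QP.
have t0 : 0 <= t := le_trans s0 st.
have lmeas w i : measurable_fun (`[0, +oo[%classic : set R) ((lam ^~ w) ^~ i).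
  exact: (predictable_section w (lpred i)).
have lrat w u i j : 0 <= u -> left_limit (X ^~ w) u j ->
    (g%:E <= ratio (lam u w i) (A i j) <= (g^-1)%:E)%E by exact: lratio.
have mF : measurable F := filt_measurable sF.
have mH : measurable (not_hit X xhat t) := filt_measurable (filt_not_hit xhat Xpj t0).
pose Mart i r w : R := (X r w == i)%:R - (X 0 w == i)%:R
          - \int[lebesgue_measure]_(u in `]0, r]) lam u w i.
have Mint i r : 0 <= r -> Q.-integrable F (EFin \o Mart i r).
  by move=> r0; have [/(_ r r0) Mi _] := lmart i; apply: integrableS Mi.
have Meq i : \int[Q]_(w in F) Mart i t w = \int[Q]_(w in F) Mart i s w.
  by have [_ /(_ s t s0 st)[_ /(_ F sF)]] := lmart i; rewrite /Rintegral => ->.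
pose W r n w := psum (fun i => psi i * Mart i r w) n.
have Wint r n : 0 <= r -> Q.-integrable F (EFin \o W r n) /\
    \int[Q]_(w in F) W r n w = psum (fun i => psi i * \int[Q]_(w in F) Mart i r w) n.
  move=> r0.
  have Mi i : Q.-integrable F (EFin \o (fun w => psi i * Mart i r w)).
    by apply: (eq_integrable _ _ _ _ (integrableZl _ (psi i) (Mint i r r0))).
  have [//|Wi WE] := @integrable_psum _ _ _ _ N _ (fun w i => psi i * Mart i r w) n _ Mi.
  split; first exact: Wi.
  rewrite [LHS]WE; congr psum; apply/funext => i.
  by rewrite RintegralZl//; exact: Mint.
(* U n dominates the truncated drift integral J n, but has the same mean for
   all n, which is what Fatou's lemma needs. *)
pose U n w := M + C * (t - s) - (W t n w - W s n w).
pose J n w := psum (fun i => psi i * (\int[lebesgue_measure]_(u in `]0, t]) lam u w i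
                        - \int[lebesgue_measure]_(u in `]0, s]) lam u w i)) n.
have psi0 j : 0 <= psi j by have /andP[+ _] := psimM j; apply/le_trans/ltW.
have UJ n w : J n w + C * (t - s) <= U n w.
  (* The terms in X 0 cancel. What is left besides J is a truncation of psi(X t), at most M, minus
     one of psi(X s), at least 0. *)
  have WJ : W t n w - W s n w = psum (fun i => if i == X t w then psi (X t w) else 0) n
      - psum (fun i => if i == X s w then psi (X s w) else 0) n - J n w.
    rewrite /W /J -!psumB; congr psum; apply/funext => i.
    rewrite /Mart ![i == _]eq_sym.
    have [->|_] := eqVneq (X t w) i; have [->|_] := eqVneq (X s w) i;
      rewrite ?mulr1n ?mulr0n; ring.
  rewrite /U WJ.
  have : psum (fun i => if i == X t w then psi (X t w) else 0) n <= M.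
    by rewrite psum_delta; case: ifP => _; have /andP[//] := psimM (X t w);
       move=> _; apply: le_trans.
  have : 0 <= psum (fun i => if i == X s w then psi (X s w) else 0) n.
    by apply: psum_ge0 => i; case: ifP.
  lra.
have J0 n w : 0 <= J n w + C * (t - s).
  exact: (drift_integral_ge xhat Aoff AK g0 m0 psimM (Xpj w) (lmeas w) (lrat w) s0 st).
have Ulim w : (F `&` not_hit X xhat t) w ->
    (((m + C) * (t - s))%:E <= limn_einf (fun n => (U n w)%:E))%E.
  move=> [_ nh].
  apply: le_trans (drift_integral_liminf Aoff AK g0 m0 psimM psi_drift
      (Xpj w) (lmeas w) (lrat w) s0 st nh) _.
  by apply: le_limn_einf => n; rewrite lee_fin; exact: UJ.
have UE n : (\int[Q]_(w in F) (U n w)%:E = (M + C * (t - s))%:E * Q F)%E.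
  have [iWt EWt] := Wint t n t0; have [iWs EWs] := Wint s n s0.
  apply: (@integral_cst_sub _ _ _ Q F (W t n) (W s n) _ mF _ iWt iWs).
    exact: (le_lt_trans (probability_le1 Q mF) (ltry 1)).
  rewrite EWt EWs.
  by apply: (congr1 (fun v => psum v n)); apply/funext => i; rewrite (Meq i).
have mU n : measurable_fun F (U n).
  apply: measurable_funB => //; apply: measurable_funB.
    by have [/integrableP[/measurable_EFinP]] := Wint t n t0.
  by have [/integrableP[/measurable_EFinP]] := Wint s n s0.
have U0 n w : F w -> 0 <= U n w by move=> _; exact: le_trans (J0 n w) (UJ n w).
have a0 : 0 <= (m + C) * (t - s).
  have K0 : 0 <= K := le_trans (normr_ge0 _) (AK xhat xhat).
  have M0 : 0 <= M := le_trans (psi0 xhat) (proj2 (andP (psimM xhat))).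
  by rewrite mulr_ge0 ?subr_ge0// addr_ge0 ?(ltW m0)// !mulr_ge0// invr_ge0 ltW.
have := fatou_lower_bound Q mF (measurableI _ _ mF mH) (@subIsetl _ _ _) mU U0 a0 Ulim.
rewrite (_ : (fun n => _) = cst ((M + C * (t - s))%:E * Q F)%E); last exact/funext.
by rewrite (cvg_limn_einf_sup (cvg_cst _)).1.
Qed.

(** Induction on n: the part of B that has avoided [xhat] up to the start of a window belongs to the
    filtration at that time, so [no_hit_step] applies to it. *)
Lemma not_hit_decay t T B n : 0 <= t -> 0 < T -> filt P X t B ->
  (Q (B `&` not_hit X xhat (t + n%:R * T))
    <= (((M + C * T) / ((m + C) * T)) ^+ n)%:E * Q B)%E.
Proof.
move=> t0 T0 tB; have mB := filt_measurable tB.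
have K0 : 0 <= K := le_trans (normr_ge0 _) (AK xhat xhat).
have M0 : 0 <= M.
  by have /andP[mpsi psiM] := psimM xhat; rewrite (le_trans _ psiM)// (le_trans _ mpsi)// ltW.
have C0 : 0 <= C by rewrite !mulr_ge0// invr_ge0 ltW.
have mC : 0 < (m + C) * T by rewrite mulr_gt0// ltr_wpDr.
have k0 : 0 <= (M + C * T) / ((m + C) * T).
  by rewrite divr_ge0 ?(ltW mC)// addr_ge0// mulr_ge0// ltW.
pose H i := not_hit X xhat (t + i%:R * T).
have r0 i : 0 <= t + i%:R * T by rewrite addr_ge0// mulr_ge0// ltW.
have fH i : filt P X (t + i%:R * T) (H i) by apply: filt_not_hit.
have fB i : filt P X (t + i%:R * T) B.
  by apply: (filt_subset _ tB); rewrite lerDl mulr_ge0// ltW.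
have mBH i : measurable (B `&` H i) by apply: measurableI => //; exact: filt_measurable (fH i).
elim: n => [|n IH].
  by rewrite expr0 mul1e le_measure ?inE//; exact: mBH.
have nS : t + n%:R * T <= t + n.+1%:R * T by rewrite lerD2l ler_pM2r// ler_nat.
have := no_hit_step (r0 n) nS (filt_setI (fB n) (fH n)).
have -> : t + n.+1%:R * T - (t + n%:R * T) = T by rewrite -natr1; ring.
have -> : B `&` H n `&` not_hit X xhat (t + n.+1%:R * T) = B `&` H n.+1.
  apply/seteqP; split => w; first by move=> [[]].
  move=> [Bw Hw]; do 2 split => //.
  by move=> u u0 un; apply: Hw => //; exact: le_trans nS.
rewrite -lee_pdivlMl// => /le_trans; apply.
rewrite muleA -EFinM [_^-1 * _]mulrC exprS [X in (_ <= X * _)%E]EFinM -muleA.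
by apply: lee_wpmul2l; [rewrite lee_fin|exact: IH].
Qed.

End OneStep.

(** * Exponential moments from geometric tails *)

(** Telescoping, q^n = 1 + sum over i < n of (q - 1) q^i, so f is dominated by S = 1 + sum of (q -
    1) q^n 1_(H n), read off at the first n with w outside H n. Integrating S gives a geometric
    series of ratio q k. *)
Lemma geometric_tail_integral {R : realType} {d} {T : measurableType d}
  (Q : probability T R) (B : set T) (H : nat -> set T) (f : T -> \bar R) (q k : R) :
  measurable B -> (forall n, measurable (H n)) -> 1 < q -> 0 <= k -> q * k < 1 ->
  (forall w, (0 <= f w)%E) ->
  (forall n w, ~ H n w -> (f w <= (q ^+ n)%:E)%E) ->
  (forall n, (Q (B `&` H n) <= (k ^+ n)%:E * Q B)%E) ->
  (\int[Q]_(w in B) f w <= (1 + (q - 1) / (1 - q * k))%:E * Q B)%E.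
Proof.
move=> mB mH q1 k0 qk f0 fq QH.
have q0 : 0 <= q by rewrite (le_trans ler01)// ltW.
have q10 : 0 <= q - 1 by rewrite subr_ge0 ltW.
pose c n := (q - 1) * q ^+ n.
have c0 n : 0 <= c n by rewrite mulr_ge0// exprn_ge0.
pose S w : \bar R := (1 + \sum_(0 <= n <oo) (c n * \1_(H n) w)%:E)%E.
have cH0 n w : (0 <= (c n * \1_(H n) w)%:E)%E by rewrite lee_fin mulr_ge0.
have Sge w n : (forall i, (i < n)%N -> H i w) -> ((q ^+ n)%:E <= S w)%E.
  move=> Hi; rewrite -[q ^+ n](subrK 1) addrC EFinD leeD2l// subrX1.
  apply: le_trans (nneseries_lim_ge n _); last by move=> i _ _.
  rewrite sumEFin lee_fin mulr_sumr big_mkord ler_sum// => i _.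
  by rewrite indicE mem_set ?mulr1//; exact: Hi.
have fS w : (f w <= S w)%E.
  have step n : (forall i, (i < n)%N -> H i w) \/ (f w <= S w)%E.
    elim: n => [|n [IH|]]; [by left| |by right].
    have [Hn|nHn] := pselect (H n w).
      by left => i; rewrite ltnS leq_eqVlt => /predU1P[->//|]; exact: IH.
    by right; exact: le_trans (fq n w nHn) (Sge w n IH).
  (* Otherwise w lies in every H n, and S w = +oo because q^n >= n (q - 1). *)
  have [//|nfS] := pselect (f w <= S w)%E.
  have allS n : ((q ^+ n)%:E <= S w)%E by apply: Sge; have [] := step n.
  suff -> : S w = +oo%E by rewrite leey.
  apply/eqyP => A A0.
  pose n := (Num.truncn (A / (q - 1))).+1.
  apply: le_trans (allS n); rewrite lee_fin.
  have nA : A <= (q - 1) * n%:R.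
    by rewrite mulrC -ler_pdivrMr ?subr_gt0// ltW// truncnS_gt.
  apply: (le_trans nA); rewrite -[q ^+ n](subrK 1) subrX1 -[leLHS]addr0 lerD// ler_wpM2l//.
  rewrite -[n in n%:R]card_ord -sumr_const ler_sum// => i _.
  by rewrite exprn_ege1// ltW.
apply: (@le_trans _ _ (\int[Q]_(w in B) S w)%E).
  by apply: ge0_le_integral_nonmeasurable.
have mcH n : measurable_fun B (fun w => (c n * \1_(H n) w)%:E).
  by apply/measurable_EFinP; apply: measurable_funM => //; exact: measurable_indic.
rewrite ge0_integralD//; last 2 first.
- by move=> w _; apply: nneseries_ge0.
- exact: ge0_emeasurable_sum.
rewrite integral_cst// mul1e integral_nneseries//.
have QBfin : Q B \is a fin_num by exact: fin_num_measure.
have -> : ((1 + (q - 1) / (1 - q * k))%:E * Q B = Q B + ((q - 1) * fine (Q B) / (1 - q * k))%:E)%E.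
  rewrite -{1 2}(fineK QBfin) -EFinM -EFinD; congr EFin.
  by rewrite mulrDl mul1r mulrAC.
rewrite leeD2l//.
have -> : ((q - 1) * fine (Q B) / (1 - q * k))%:E =
    (\sum_(0 <= n <oo) (geometric ((q - 1) * fine (Q B)) (q * k) n)%:E)%E.
  have qk0 : 0 <= q * k by rewrite mulr_ge0.
  have := @cvg_geometric_series R ((q - 1) * fine (Q B)) (q * k).
  rewrite ger0_norm// => /(_ qk) cvgg.
  apply/esym/cvg_lim => //.
  rewrite (_ : (fun n => _) = EFin \o series (geometric ((q - 1) * fine (Q B)) (q * k))).
    by apply: cvg_EFin => //; apply: nearW.
  by apply/funext => n /=; rewrite sumEFin seriesEnat.
apply: lee_nneseries => [n _ _|n _]; first exact: integral_ge0.
rewrite (_ : (fun w => _) = (fun w => (c n)%:E * (\1_(H n) w)%:E)%E); last by apply/funext.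
rewrite ge0_integralZl_EFin//; last exact/measurable_EFinP/measurable_indic.
rewrite integral_indic// setIC.
apply: (@le_trans _ _ ((c n)%:E * ((k ^+ n)%:E * Q B))%E).
  by apply: lee_wpmul2l; [exact: c0|exact: QH].
rewrite -{1}(fineK QBfin) -!EFinM lee_fin /c /geometric /= exprMn.
by rewrite le_eqVlt; apply/orP; left; apply/eqP; ring.
Qed.

(** The event g >= a + 1 / (n + 1) belongs to G; integrating over it forces its measure to be 0.
    These events exhaust the set where g > a. *)
Lemma cond_exp_le {R : realType} {d : measure_display} {Omega : measurableType d}
    (Q : probability Omega R) (G : set (set Omega)) (f g : Omega -> \bar R) a :
  G `<=` measurable -> is_cond_exp Q G f g -> 0 <= a ->
  (forall B, G B -> (\int[Q]_(w in B) f w <= a%:E * Q B)%E) ->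
  {ae Q, forall w, (g w <= a%:E)%E}.
Proof.
move=> Gm [gm gf] a0 fa.
pose b n : R := a + n.+1%:R^-1.
have ab n : a < b n by rewrite ltrDl invr_gt0.
pose B n := g @^-1` [set y | ((b n)%:E <= y)%E].
have mB n : measurable [set y : \bar R | ((b n)%:E <= y)%E].
  rewrite (_ : mkset _ = `[(b n)%:E, +oo[%classic); first exact: emeasurable_itv.
  by apply/seteqP; split => y /=; rewrite in_itv/= andbT.
have GB n : G (B n) := gm _ (mB n).
have QB0 n : Q (B n) = 0%E.
  have mBn : measurable (B n) := Gm _ (GB n).
  have QBfin : Q (B n) \is a fin_num by exact: fin_num_measure.
  have : ((b n)%:E * Q (B n) <= a%:E * Q (B n))%E.
    apply: le_trans (fa _ (GB n)); rewrite gf// -integral_cst//.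
    apply: ge0_le_integral_nonmeasurable => //= w _.
    by rewrite lee_fin (le_trans a0)// ltW.
  rewrite -(fineK QBfin) -!EFinM lee_fin -subr_ge0 -mulrBl.
  rewrite nmulr_rge0 ?subr_lt0// => Q0.
  congr EFin; apply/eqP; rewrite eq_le Q0/=.
  by rewrite fine_ge0.
apply: (@negligibleS _ _ _ _ (\bigcup_n B n)).
  move=> w /= /negP; rewrite -ltNge => agw.
  case E : (g w) agw => [y| |//] => [|_]; last first.
    by exists 0%N => //=; rewrite /B /= E leey.
  rewrite lte_fin => ay.
  pose n := Num.truncn (y - a)^-1.
  have := truncnS_gt ((y - a)^-1); rewrite -/n => yn.
  have nya : n.+1%:R^-1 < y - a.
    by rewrite invf_plt ?posrE ?subr_gt0.
  by exists n => //=; rewrite /B /= E lee_fin /b addrC -lerBrDr ltW.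
apply: negligible_bigcup => n.
by apply/negligibleP; [exact: Gm|exact: QB0].
Qed.

Section Hitting.
Context {R : realType} {N : option nat} {Omega : Type}.
Variables (X : R -> Omega -> state N) (x : state N).

Lemma exp_hitting_le (beta t T : R) (n : nat) (w : Omega) : 0 <= beta -> 0 <= T ->
    ~ not_hit X x (t + n%:R * T) w ->
  (expeR (beta%:E * maxe (hitting_time X x w - t%:E) 0) <= (expR (beta * T) ^+ n)%:E)%E.
Proof.
move=> beta0 T0; move=> /existsNP[u /not_implyP[u0 /not_implyP[ut /negP/negPn/eqP ux]]].
rewrite -expRM_natl;
    change (expeR (beta%:E * maxe (hitting_time X x w - t%:E) 0) <= expeR (n%:R * (beta * T))%:E)%E.
rewrite lee_expeR mulrCA EFinM lee_wpmul2l ?lee_fin//.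
have nT0 : 0 <= n%:R * T by rewrite mulr_ge0.
rewrite ge_max lee_fin nT0 andbT leeBlDr// -EFinD.
apply: (@le_trans _ _ u%:E); last by rewrite lee_fin addrC.
by apply: ereal_inf_lbound; exists u.
Qed.

End Hitting.

Theorem theorem9 (R : realType) (N : option nat)
  (A : state N -> state N -> R) (pi : state N -> R) (gamma : R)
  (xhat : state N)
  (hA : rate_matrix A) (herg : uniformly_ergodic A pi)
  (hxhat : 0 < pi xhat) (hgamma : 0 < gamma)
  (eps : R) (heps : 0 < eps) :
  exists2 beta : R, 0 < beta &
    forall (d : measure_display) (Omega : measurableType d)
      (P : probability Omega R) (X : R -> Omega -> state N),
      (forall w, pure_jump (X ^~ w)) ->
      markov_chain P X A ->
      (measurable : set (set Omega)) = filt_oo P X ->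
      forall Q : probability Omega R, Qgamma P X A gamma Q ->
      forall t : R, 0 <= t ->
      forall g : Omega -> \bar R,
        is_cond_exp Q (filt P X t)
          (fun w => expeR (beta%:E * maxe (hitting_time X xhat w - t%:E) 0)%E)
          g ->
        {ae Q, forall w, (g w <= (1 + eps)%:E)%E}.
Proof.
have [Aoff _ [K AK]] := hA.
have K0 : 0 <= K := le_trans (normr_ge0 _) (AK xhat xhat).
have gV0 : 0 < gamma^-1 by rewrite invr_gt0.
have gK0 : 0 <= gamma^-1 * K by rewrite mulr_ge0// ltW.
(* The rate c of the resolvent: gamma c = K / gamma + 1 absorbs the diagonal loss and leaves a drift
   of psi itself. *)
have c0 : 0 < gamma^-1 * (gamma^-1 * K + 1) by rewrite mulr_gt0// ltr_wpDl.
have [psi [m [M [m0 psimM psi_drift]]]] := exists_potential hA herg hxhat c0.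
have M0 : 0 < M.
  by have /andP[mpsi psiM] := psimM xhat; rewrite (lt_le_trans m0)// (le_trans mpsi).
pose C := gamma^-1 * K * M.
have C0 : 0 <= C by rewrite mulr_ge0// ltW.
(* With m T = 2 M the window factor k becomes (M + C T) / (2 M + C T) < 1. *)
pose T := 2 * M / m.
have T0 : 0 < T by rewrite divr_gt0// mulr_gt0.
pose k := (M + C * T) / ((m + C) * T).
have mCT : (m + C) * T = 2 * M + C * T.
  by rewrite mulrDl /T mulrCA divff ?mulr1// gt_eqF.
have CT0 : 0 <= C * T by rewrite mulr_ge0// ltW.
have k0 : 0 <= k by rewrite /k mCT divr_ge0//; lra.
have k1 : k < 1 by rewrite /k mCT ltr_pdivrMr ?mul1r; lra.
(* Chosen so that q = 1 + eta satisfies both q k < 1 and eta / (1 - q k) <= eps. *)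
pose eta := eps * (1 - k) / (1 + eps).
have e1 : 0 < 1 + eps by lra.
have eta0 : 0 < eta by rewrite divr_gt0// mulr_gt0// subr_gt0.
have etaE : eta * (1 + eps) = eps * (1 - k) by rewrite mulfVK// gt_eqF.
have etak : eta * k <= eta by rewrite ler_piMr ?(ltW eta0)// ltW.
have eta_lt : eta < 1 - k.
  by rewrite /eta ltr_pdivrMr// mulrC ltr_pM2l ?subr_gt0//; lra.
have qk : (1 + eta) * k < 1 by rewrite mulrDl mul1r; lra.
have lnq : 0 < ln (1 + eta) by apply: ln_gt0; lra.
(* Each window of length T then costs a factor exp (beta T) = 1 + eta. All constants are fixed
   before the probability space, Q and t are introduced. *)
exists (ln (1 + eta) / T); first by rewrite divr_gt0.
set beta := ln _ / _.
have expq : expR (beta * T) = 1 + eta.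
  by rewrite /beta divfK ?gt_eqF// lnK// posrE; lra.
move=> d Omega P X Xpj _ measE Q QP t t0 g hg.
have filtm : filt P X t `<=` measurable by move=> B; exact: filt_measurable.
apply: (cond_exp_le filtm hg) => [|B tB]; first exact: ltW.
apply: le_trans (geometric_tail_integral (H := fun n => not_hit X xhat (t + n%:R * T))
   (filtm _ tB) _ _ k0 qk _ _ _) _.
- move=> n; apply: (filt_measurable measE (t := t + n%:R * T)).
  by apply: filt_not_hit => //; rewrite addr_ge0// mulr_ge0// ltW.
- by lra.
- by move=> w; exact: expeR_ge0.
- move=> n w nH; rewrite -expq; apply: exp_hitting_le nH => //; last exact: ltW.
  by rewrite divr_ge0// ltW.
- move=> n; exact: (not_hit_decay Aoff AK hgamma m0 psimM psi_drift Xpj measE QP _ t0 T0 tB).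
apply: lee_wpmul2r => //.
rewrite lee_fin lerD2l ler_pdivrMr ?subr_gt0//.
(* Since eta (1 + eps) = eps (1 - k), the claim eta <= eps (1 - (1 + eta) k) reduces to this
   inequality. *)
have : eta * (eps * k) <= eta * eps by rewrite ler_pM2l// ler_piMr// ltW.
lra.
Qed.
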